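(* Let $A$ and $B$ be Banach algebras, let $\phi\in Hom(B,\mathbb{C})$ and let $\varphi\in Hom(A,\mathbb{C})$. Let $\rho_{(\varphi,\phi)}\in Hom(A\oplus_\phi B,\mathbb{C})$ be the character $\rho_{(\varphi,\phi)}(a_1,a_2)=\varphi(a_1)+\phi(a_2)$, $(a_1,a_2)\in A\oplus_\phi B$. Then $A\oplus_\phi B$ is $\rho_{(\varphi,\phi)}$-amenable if and only if $A$ is $\varphi$-amenable.
   Context: For a Banach algebra $C$, $Hom(C,\mathbb{C})$ is the set of all nonzero homomorphisms from $C$ into $\mathbb{C}$. For $f\in C^\ast$ and $a\in C$, $f\cdot a\in C^\ast$ is defined by $\langle f\cdot a,b\rangle=\langle f,ab\rangle$ ($b\in C$). For $\theta\in Hom(C,\mathbb{C})$, $C$ is called $\theta$-amenable if there exists $m\in C^{\ast\ast}$ such that (i) $m(\theta)=1$ and (ii) $m(f\cdot a)=\theta(a)m(f)$ for every $f\in C^\ast$ and $a\in C$. $A\oplus_\phi B$ is the Banach algebra of all ordered pairs $(a,b)$, $a\in A$, $b\in B$, with coordinatewise addition and scalar multiplication, product $(a_1,a_2)\cdot_\phi(b_1,b_2)=(a_1b_1+\phi(a_2)b_1+\phi(b_2)a_1,\ a_2b_2)$, and norm $\|(a_1,a_2)\|_{\oplus_\phi}=\|a_1\|+\|a_2\|$. *)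

(* Defs.v *)
From HB Require Import structures.
From mathcomp Require Import all_boot all_order all_algebra complex.
From mathcomp Require Import all_classical reals topology normedtype sequences.

Set Implicit Arguments.
Unset Strict Implicit.
Unset Printing Implicit Defensive.

Import Order.TTheory GRing.Theory Num.Theory.
Import numFieldNormedType.Exports.

Local Open Scope classical_set_scope.
Local Open Scope ring_scope.
Local Open Scope complex_scope.

(* Banach algebras are not assumed to be unital or commutative. *)
HB.mixin Record CompleteNormedModule_isBanachAlgebra (K : numFieldType) A
    & CompleteNormedModule K A := {
  bmul : A -> A -> A;
  bmulA : associative bmul;
  bmulDl : left_distributive bmul +%R;
  bmulDr : right_distributive bmul +%R;
  bmulZl : forall (k : K) (a b : A), bmul (k *: a) b = k *: bmul a b;
  bmulZr : forall (k : K) (a b : A), bmul a (k *: b) = k *: bmul a b;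
  ler_norm_bmul : forall a b : A, `|bmul a b| <= `|a| * `|b|
}.

#[short(type="banachAlgType")]
HB.structure Definition BanachAlgebra (K : numFieldType) :=
  {A of CompleteNormedModule K A & CompleteNormedModule_isBanachAlgebra K A}.

(* The topological dual of a complex normed space, with the operator norm. *)
Record dual (R : realType) (V : normedModType R[i]) := Dual {
  dual_fun :> {linear V -> R[i]^o};
  dual_continuous : continuous dual_fun
}.

Section Dual.
Context {R : realType}.
Local Notation C := R[i].
Variable V : normedModType C.
Implicit Types f g h : dual V.

HB.instance Definition _ := gen_eqMixin (dual V).
HB.instance Definition _ := gen_choiceMixin (dual V).

Lemma dualP f g : f =1 g -> f = g.
Proof.
case: f g => [[f [[fA] [fZ]]] cf] [[g [[gA] [gZ]]] cg] /= /funext fg.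
move: fA fZ cf; rewrite {}fg => fA fZ cf.
have -> : fA = gA by exact: Prop_irrelevance.
have eZ : fZ = gZ by exact: Prop_irrelevance.
move: cf; rewrite eZ => cf.
by congr Dual; exact: Prop_irrelevance.
Qed.

Lemma le_continuous (f : {linear V -> C^o}) (M : C) :
  (forall x, `|f x| <= M * `|x|) -> continuous f.
Proof.
move=> fM; apply/linear_bounded_continuous/bounded_funP => r.
have [r0|r0] := boolP (0 <= r); last first.
  exists 0 => x xr; move: r0; rewrite (le_trans _ xr)//.
exists (`|M| * r) => x xr; apply: (le_trans (fM x)).
have [->|x0] := eqVneq x 0; first by rewrite normr0 mulr0 mulr_ge0.
have M0 : 0 <= M.
  by rewrite -(pmulr_lge0 _ (_ : 0 < `|x|)) ?normr_gt0// (le_trans _ (fM x)).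
by rewrite (ger0_norm M0) ler_wpM2l.
Qed.

Lemma dual_bounded f : exists2 M : C, 0 < M & forall x, `|f x| <= M * `|x|.
Proof.
have /linear_bounded_continuous/linear_boundedP := @dual_continuous _ _ f.
by move=> /pinfty_ex_gt0 [M M0 fM]; exists M.
Qed.

(* A functional bundled from its graph and a bound. *)
Section MkDual.
Variables (f : V -> C^o) (f_linear : linear f).
Variables (M : C) (f_le : forall x, `|f x| <= M * `|x|).

Let F : V -> C^o := f.
HB.instance Definition _ := GRing.isLinear.Build C V C^o *:%R F f_linear.

Definition mkdual : dual V := @Dual R V F (@le_continuous F M f_le).

End MkDual.

Fact dual0_linear : linear ((fun=> 0) : V -> C^o).
Proof. by move=> k x y; rewrite scaler0 addr0. Qed.
Fact dual0_le (x : V) : `|(0 : C)| <= 0 * `|x|.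
Proof. by rewrite normr0 mul0r. Qed.
Definition dual0 := mkdual dual0_linear dual0_le.

Fact dualN_linear f : linear (fun x => - f x : C^o).
Proof. by move=> k x y; rewrite linearP opprD scalerN. Qed.
Fact dualN_le f : exists M : C, forall x, `|- f x| <= M * `|x|.
Proof. by have [M _ fM] := dual_bounded f; exists M => x; rewrite normrN. Qed.
Definition dualN f := mkdual (dualN_linear f) (projT2 (cid (dualN_le f))).

Fact dualD_linear f g : linear (fun x => f x + g x : C^o).
Proof. by move=> k x y; rewrite !linearP scalerDr addrACA. Qed.
Fact dualD_le f g : exists M : C, forall x, `|f x + g x| <= M * `|x|.
Proof.
have [M _ fM] := dual_bounded f; have [N _ gN] := dual_bounded g.
by exists (M + N) => x; rewrite mulrDl (le_trans (ler_normD _ _))// lerD.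
Qed.
Definition dualD f g := mkdual (dualD_linear f g) (projT2 (cid (dualD_le f g))).

Fact dualZ_linear (k : C) f : linear (fun x => k *: f x : C^o).
Proof. by move=> c x y; rewrite linearP scalerDr !scalerA mulrC. Qed.
Fact dualZ_le (k : C) f : exists M : C, forall x, `|k *: f x| <= M * `|x|.
Proof.
have [M _ fM] := dual_bounded f.
by exists (`|k| * M) => x; rewrite normrZ -mulrA ler_wpM2l.
Qed.
Definition dualZ k f := mkdual (dualZ_linear k f) (projT2 (cid (dualZ_le k f))).

Fact dual_addA : associative dualD.
Proof. by move=> f g h; apply: dualP => x /=; rewrite addrA. Qed.
Fact dual_addC : commutative dualD.
Proof. by move=> f g; apply: dualP => x /=; rewrite addrC. Qed.
Fact dual_add0 : left_id dual0 dualD.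
Proof. by move=> f; apply: dualP => x /=; rewrite add0r. Qed.
Fact dual_addN : left_inverse dual0 dualN dualD.
Proof. by move=> f; apply: dualP => x /=; rewrite addNr. Qed.

HB.instance Definition _ := GRing.isZmodule.Build (dual V)
  dual_addA dual_addC dual_add0 dual_addN.

Fact dual_scaleA a b f : dualZ a (dualZ b f) = dualZ (a * b) f.
Proof. by apply: dualP => x /=; rewrite scalerA. Qed.
Fact dual_scale1 : left_id 1 dualZ.
Proof. by move=> f; apply: dualP => x /=; rewrite scale1r. Qed.
Fact dual_scaleDr : right_distributive dualZ +%R.
Proof. by move=> a f g; apply: dualP => x /=; rewrite scalerDr. Qed.
Fact dual_scaleDl f : {morph dualZ^~ f : a b / a + b}.
Proof. by move=> a b; apply: dualP => x /=; rewrite scalerDl. Qed.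

HB.instance Definition _ := GRing.Zmodule_isLmodule.Build C (dual V)
  dual_scaleA dual_scale1 dual_scaleDr dual_scaleDl.

(* The norm of a normed module over C takes its values in C, hence the
   projection Re before taking the real supremum, and the injection %:C. *)
Definition opnorm f : C :=
  (sup [set complex.Re `|f x| | x in [set x : V | `|x| <= 1]])%:C.

Lemma RRe_norm (W : normedZmodType C) (w : W) : (complex.Re `|w|)%:C = `|w|.
Proof. by rewrite RRe_real// normr_real. Qed.

Lemma opnorm_has_sup f :
  has_sup [set complex.Re `|f x| | x in [set x : V | `|x| <= 1]].
Proof.
split; first by exists (complex.Re `|f 0|), 0 => //=; rewrite normr0 ler01.
have [M M0 fM] := dual_bounded f; exists (complex.Re M) => _ [x x1 <-].
rewrite -lecR RRe_norm (RRe_real (gtr0_real M0)) (le_trans (fM x))//.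
by rewrite ler_piMr// ltW.
Qed.

Lemma opnorm_ge0 f : 0 <= opnorm f.
Proof.
rewrite /opnorm ler0c.
have /(ub_le_sup (opnorm_has_sup f).2) : [set complex.Re `|f x| |
    x in [set x : V | `|x| <= 1]] (complex.Re `|f 0|).
  by exists 0 => //=; rewrite normr0 ler01.
by apply: le_trans; rewrite -ler0c RRe_norm.
Qed.

Lemma le_opnorm f x : `|f x| <= opnorm f * `|x|.
Proof.
have [->|x0] := eqVneq x 0; first by rewrite linear0 !normr0 mulr0.
have nx0 : 0 < `|x| by rewrite normr_gt0.
rewrite -ler_pdivrMr// mulrC.
have -> : `|x|^-1 * `|f x| = `|f (`|x|^-1 *: x)|.
  by rewrite linearZ/= normrZ ger0_norm// invr_ge0.
rewrite -RRe_norm lecR; apply: ub_le_sup; first exact: (opnorm_has_sup f).2.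
by exists (`|x|^-1 *: x) => //=; rewrite normfZV.
Qed.

Lemma opnorm_le f (M : C) : 0 <= M -> (forall x, `|f x| <= M * `|x|) ->
  opnorm f <= M.
Proof.
move=> M0 fM; rewrite -(RRe_real (ger0_real M0)) lecR.
apply: ge_sup; first exact: (opnorm_has_sup f).1.
move=> _ [x x1 <-].
rewrite -lecR RRe_norm (RRe_real (ger0_real M0)) (le_trans (fM x))//.
by rewrite ler_piMr.
Qed.

Fact opnormD f g : opnorm (f + g) <= opnorm f + opnorm g.
Proof.
apply: opnorm_le => [|x]; first by rewrite addr_ge0 ?opnorm_ge0.
by rewrite mulrDl (le_trans (ler_normD _ _))// lerD ?le_opnorm.
Qed.

Fact opnormZ (k : C) f : opnorm (k *: f) = `|k| * opnorm f.
Proof.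
have le k' h : opnorm (k' *: h) <= `|k'| * opnorm h.
  apply: opnorm_le => [|x]; first by rewrite mulr_ge0 ?opnorm_ge0.
  by rewrite normrZ -mulrA ler_wpM2l ?le_opnorm.
apply/le_anti; rewrite le/=.
have [->|k0] := eqVneq k 0; first by rewrite normr0 mul0r opnorm_ge0.
rewrite -ler_pdivlMl ?normr_gt0// -normfV.
by rewrite -{1}[f]scale1r -(mulVf k0) -scalerA.
Qed.

Fact opnorm_eq0 f : opnorm f = 0 -> f = 0.
Proof.
move=> f0; apply: dualP => x /=; apply/normr0_eq0/le_anti.
by rewrite normr_ge0 (le_trans (le_opnorm _ _))// f0 mul0r.
Qed.

HB.instance Definition _ := Lmodule_isNormed.Build C (dual V)
  opnormD opnormZ opnorm_eq0.

End Dual.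

(* Hom(A, C): continuity is not part of the definition, it is automatic
   (character_le below). *)
Record character (R : realType) (A : banachAlgType R[i]) := Character {
  character_fun :> {linear A -> R[i]^o};
  characterM : forall a b : A,
    character_fun (bmul a b) = character_fun a * character_fun b;
  character_neq0 : exists a : A, character_fun a != 0
}.

Section AutomaticContinuity.
Context {R : realType} {A : banachAlgType R[i]}.
Local Notation C := R[i].
Variable theta : character A.

Lemma bmulNr (a b : A) : bmul a (- b) = - bmul a b.
Proof. by rewrite -scaleN1r bmulZr scaleN1r. Qed.

Lemma bmulBr (a b c : A) : bmul a (b - c) = bmul a b - bmul a c.
Proof. by rewrite bmulDr bmulNr. Qed.

Lemma expr_small (q eps : C) : 0 <= q -> q < 1 -> 0 < eps ->
  exists n, q ^+ n < eps.
Proof.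
move=> q0 q1 e0.
have eqq : (complex.Re q)%:C = q by rewrite RRe_real// ger0_real.
have eqe : (complex.Re eps)%:C = eps by rewrite RRe_real// gtr0_real.
have r0 : 0 <= complex.Re q by rewrite -ler0c eqq.
have r1 : `|complex.Re q| < 1 by rewrite ger0_norm// -ltcR eqq.
have s0 : 0 < complex.Re eps by rewrite -ltcR eqe.
have /cvgrPdist_lt /(_ _ s0) [n _ /(_ n (leqnn n))] := cvg_geometric 1 r1.
rewrite /= sub0r normrN mul1r ger0_norm ?exprn_ge0// => h.
by exists n; rewrite -eqq -eqe -rmorphXn ltcR.
Qed.

Lemma quasi_fixpoint (a : A) : `|a| < 1 -> exists b : A, b = a + bmul a b.
Proof.
move=> a1; pose u n := iter n (fun b => a + bmul a b) 0.
have a1' : 0 < 1 - `|a| by rewrite subr_gt0.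
have uE n : u n.+1 = a + bmul a (u n) by [].
have uS n m : `|u (n + m)%N - u n| <= `|a| ^+ n * `|u m|.
  elim: n => [|n IH]; first by rewrite add0n expr0 mul1r subr0.
  rewrite addSn !uE opprD addrACA subrr add0r -bmulBr.
  by rewrite (le_trans (ler_norm_bmul _ _))// exprS -mulrA ler_wpM2l.
pose c := `|a| / (1 - `|a|).
have cE : `|a| + `|a| * c = c.
  rewrite /c -[X in X + _](mulfK (lt0r_neq0 a1')) mulrA -mulrDl.
  by rewrite mulrBr mulr1 subrK.
have c0 : 0 <= c by rewrite divr_ge0// ltW.
have ub m : `|u m| <= c.
  elim: m => [|m IH]; first by rewrite normr0.
  rewrite uE (le_trans (ler_normD _ _))// -cE lerD2l.
  by rewrite (le_trans (ler_norm_bmul _ _))// ler_wpM2l.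
have ucvg : cvgn u.
  apply/cauchy_cvgP/cauchy_exP => e e0.
  have c1 : 0 < c + 1 by rewrite ltr_wpDl.
  have [n qn] := expr_small (normr_ge0 a) a1 (divr_gt0 e0 c1).
  exists (u n), n => // m /= nm; rewrite -ball_normE /= distrC -(subnKC nm).
  rewrite (le_lt_trans (uS _ _))// (@le_lt_trans _ _ (`|a| ^+ n * (c + 1)))//.
    by rewrite ler_wpM2l ?exprn_ge0// (le_trans (ub _))// lerDl.
  by rewrite -ltr_pdivlMr.
exists (limn u); apply/eqP; rewrite -subr_eq0 -normr_le0; apply/ler_addgt0Pr.
move=> e e0; rewrite add0r.
have e2 : 0 < e / 2 by rewrite divr_gt0.
have /cvgrPdist_lt /(_ _ e2) [n _ un] := ucvg.
rewrite -(subrKA (u n.+1)) (le_trans (ler_normD _ _))// [leRHS]splitr.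
apply: lerD; first by rewrite ltW// un//=.
rewrite uE opprD addrACA subrr add0r -bmulBr.
have /ltW := un n (leqnn n); apply: le_trans.
by rewrite -normrN -bmulNr opprB (le_trans (ler_norm_bmul _ _))// ler_piMl// ltW.
Qed.

Lemma character_le (a : A) : `|theta a| <= `|a|.
Proof.
rewrite real_leNgt ?normr_real//; apply/negP => lt_a.
have t0 : theta a != 0 by rewrite -normr_gt0 (le_lt_trans _ lt_a).
have [|b /(congr1 theta)] := @quasi_fixpoint ((theta a)^-1 *: a).
  by rewrite normrZ normfV ltr_pdivrMl ?mulr1// normr_gt0.
have -> : theta b = 0 + theta b by rewrite add0r.
rewrite linearD characterM linearZ /= /GRing.scale/= mulVf// mul1r.
by move=> /addIr/esym/eqP; rewrite oner_eq0.
Qed.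

Lemma character_continuous : continuous theta.
Proof.
by apply: (@le_continuous _ _ _ 1) => a; rewrite mul1r character_le.
Qed.

End AutomaticContinuity.

Section Amenability.
Context {R : realType} {A : banachAlgType R[i]}.
Local Notation C := R[i].

Definition character_dual (theta : character A) : dual A :=
  Dual (@character_continuous R A theta).

Section DualAct.
Variables (f : dual A) (a : A).

Fact dual_act_linear : linear (fun b => f (bmul a b) : C^o).
Proof. by move=> k b c; rewrite bmulDr bmulZr linearP. Qed.

Fact dual_act_le (b : A) : `|f (bmul a b)| <= (opnorm f * `|a|) * `|b|.
Proof.
rewrite (le_trans (le_opnorm _ _))// -mulrA.
by rewrite ler_wpM2l ?opnorm_ge0// ler_norm_bmul.
Qed.

Definition dual_act : dual A := mkdual dual_act_linear dual_act_le.

End DualAct.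

Definition amenable (theta : character A) : Prop :=
  exists m : dual (dual A),
    m (character_dual theta) = 1 /\
    forall (f : dual A) (a : A), m (dual_act f a) = theta a * m f.

End Amenability.

(* A alias of the product A * B, so as not to inherit its maximum norm. *)
Definition lau_sum (R : realType) (A B : banachAlgType R[i])
  (phi : character B) : Type := (A * B)%type.

Section LauSum.
Context {R : realType} {A B : banachAlgType R[i]} (phi : character B).
Local Notation C := R[i].
Local Notation S := (lau_sum A phi).

HB.instance Definition _ := GRing.Lmodule.copy S (A * B)%type.

Definition lau_norm (x : S) : C := `|x.1| + `|x.2|.

Fact lau_normD (x y : S) : lau_norm (x + y) <= lau_norm x + lau_norm y.
Proof. by rewrite /lau_norm addrACA lerD// ler_normD. Qed.

Fact lau_normZ (k : C) (x : S) : lau_norm (k *: x) = `|k| * lau_norm x.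
Proof. by rewrite /lau_norm !normrZ mulrDr. Qed.

Fact lau_norm_eq0 (x : S) : lau_norm x = 0 -> x = 0.
Proof.
case: x => a b /eqP; rewrite /lau_norm paddr_eq0//= !normr_eq0.
by move=> /andP[/eqP-> /eqP->].
Qed.

HB.instance Definition _ := Lmodule_isNormed.Build C S
  lau_normD lau_normZ lau_norm_eq0.

Lemma lau_normE (x : S) : `|x| = `|x.1| + `|x.2|. Proof. by []. Qed.

Lemma lau_norm1_le (x : S) : `|x.1| <= `|x|.
Proof. by rewrite lau_normE lerDl. Qed.

Lemma lau_norm2_le (x : S) : `|x.2| <= `|x|.
Proof. by rewrite lau_normE lerDr. Qed.

Fact lau_complete (F : set_system S) : ProperFilter F -> cauchy F -> cvg F.
Proof.
move=> FF /cauchyP Fc.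
have c1 : cauchy ((fun x : S => x.1) @ F).
  apply/cauchy_exP => e e0; have [x Fx] := Fc e e0; exists x.1.
  apply: (@filterS _ F _ (ball x e) [set y : S | ball x.1 e y.1]) Fx => y.
  by rewrite /= -!ball_normE; exact: (le_lt_trans (lau_norm1_le (x - y))).
have c2 : cauchy ((fun x : S => x.2) @ F).
  apply/cauchy_exP => e e0; have [x Fx] := Fc e e0; exists x.2.
  apply: (@filterS _ F _ (ball x e) [set y : S | ball x.2 e y.2]) Fx => y.
  by rewrite /= -!ball_normE; exact: (le_lt_trans (lau_norm2_le (x - y))).
have [l1 F1] : exists l : A, (fun x : S => x.1) @ F --> l.
  by exists (lim ((fun x : S => x.1) @ F)); exact: cauchy_cvg c1.
have [l2 F2] : exists l : B, (fun x : S => x.2) @ F --> l.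
  by exists (lim ((fun x : S => x.2) @ F)); exact: cauchy_cvg c2.
pose l : S := (l1, l2).
apply: (@cvgP _ _ l); apply/cvgrPdist_lt => e e0.
have e2 : 0 < e / 2 by rewrite divr_gt0.
move/cvgrPdist_lt: F1 => /(_ _ e2) F1; move/cvgrPdist_lt: F2 => /(_ _ e2) F2.
near=> x; rewrite lau_normE [ltRHS]splitr ltrD//=; near: x => //.
Unshelve. all: by end_near. Qed.

HB.instance Definition _ := Uniform_isComplete.Build S lau_complete.

Definition lau_mul (x y : S) : S :=
  (bmul x.1 y.1 + phi x.2 *: y.1 + phi y.2 *: x.1, bmul x.2 y.2).

Fact lau_mulA : associative lau_mul.
Proof.
move=> x y z; congr pair; last exact: bmulA.
rewrite /= !(bmulDl, bmulDr, bmulZl, bmulZr, scalerDr, scalerA) !characterM.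
rewrite bmulA !(mulrC (phi z.2)).
by rewrite [LHS](AC (3*3*1) ((1*4*2*5)*(3*6*7))).
Qed.

Fact lau_mulDl : left_distributive lau_mul +%R.
Proof.
move=> x y z; congr pair; last exact: bmulDl.
rewrite /= [phi (_ + _)]linearD bmulDl scalerDl scalerDr.
by rewrite [LHS](AC (2*2*2) ((1*3*5)*(2*4*6))).
Qed.

Fact lau_mulDr : right_distributive lau_mul +%R.
Proof.
move=> x y z; congr pair; last exact: bmulDr.
rewrite /= [phi (_ + _)]linearD bmulDr scalerDl scalerDr.
by rewrite [LHS](AC (2*2*2) ((1*3*5)*(2*4*6))).
Qed.

Fact lau_mulZl (k : C) (x y : S) : lau_mul (k *: x) y = k *: lau_mul x y.
Proof.
congr pair; last exact: bmulZl.
rewrite /= [phi (_ *: _)]linearZ bmulZl !scalerDr !scalerA /=.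
by rewrite [phi y.2 * k]mulrC.
Qed.

Fact lau_mulZr (k : C) (x y : S) : lau_mul x (k *: y) = k *: lau_mul x y.
Proof.
congr pair; last exact: bmulZr.
rewrite /= [phi (_ *: _)]linearZ bmulZr !scalerDr !scalerA /=.
by rewrite [phi x.2 * k]mulrC.
Qed.

Fact lau_norm_mul (x y : S) : `|lau_mul x y| <= `|x| * `|y|.
Proof.
rewrite !lau_normE /= mulrDl !mulrDr addrA lerD ?ler_norm_bmul//.
rewrite (le_trans (ler_normD _ _))// addrAC lerD//.
  rewrite (le_trans (ler_normD _ _))// lerD ?ler_norm_bmul//.
  by rewrite normrZ ler_wpM2r// character_le.
by rewrite normrZ mulrC ler_wpM2l// character_le.
Qed.

HB.instance Definition _ := CompleteNormedModule_isBanachAlgebra.Build C S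
  lau_mulA lau_mulDl lau_mulDr lau_mulZl lau_mulZr lau_norm_mul.

Definition rho_fun (varphi : character A) (x : S) : C^o := varphi x.1 + phi x.2.

Section Rho.
Variable varphi : character A.

Fact rho_linear : linear (rho_fun varphi).
Proof.
by move=> k x y; rewrite /rho_fun !linearP scalerDr addrACA.
Qed.

HB.instance Definition _ :=
  GRing.isLinear.Build C S C^o *:%R (rho_fun varphi) rho_linear.

Fact rhoM (x y : S) :
  rho_fun varphi (bmul x y) = rho_fun varphi x * rho_fun varphi y.
Proof.
rewrite /rho_fun /= !linearD !linearZ !characterM /= mulrDl !mulrDr.
by rewrite -!addrA; congr (_ + _); rewrite addrCA [varphi x.1 * _]mulrC.
Qed.

Fact rho_neq0 : exists x : S, rho_fun varphi x != 0.
Proof.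
have [a a0] := character_neq0 varphi.
by exists ((a, 0) : S); rewrite /rho_fun/= linear0 addr0.
Qed.

Definition rho : character S := @Character R S (rho_fun varphi) rhoM rho_neq0.

End Rho.
End LauSum.

(* Main.v *)
Require Import Defs.
From mathcomp Require Import all_boot all_order all_algebra complex.
From mathcomp Require Import all_classical reals topology normedtype sequences.

(** Write S for the sum and identify A with the ideal of pairs (a, 0). A mean on
    A is pushed forward to S along the inclusion. Conversely a mean m on S is
    pushed forward to A along the first projection p, which is not multiplicative;
    but if varphi a0 = 1 then m F = m (F . (a0, 0)), and F . (a0, 0) only sees
    products with an element of the ideal A, on which p behaves well. *)

Set Implicit Arguments.
Unset Strict Implicit.
Unset Printing Implicit Defensive.

Import Order.TTheory GRing.Theory Num.Theory.
Import numFieldNormedType.Exports.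

Local Open Scope ring_scope.
Local Open Scope complex_scope.

Section Adjoint.
Context {R : realType} {V W : normedModType R[i]}.
Variables (T : V -> W) (T_linear : linear T) (T_le : forall x, `|T x| <= `|x|).

Fact adjoint_fun_linear (g : dual W) : linear (fun x => g (T x) : R[i]^o).
Proof. by move=> k x y; rewrite T_linear linearP. Qed.

Fact adjoint_fun_le (g : dual W) x : `|g (T x)| <= opnorm g * `|x|.
Proof. by rewrite (le_trans (le_opnorm _ _))// ler_wpM2l ?opnorm_ge0. Qed.

Definition adjoint (g : dual W) : dual V :=
  mkdual (adjoint_fun_linear g) (adjoint_fun_le g).

Lemma adjointE g x : adjoint g x = g (T x). Proof. by []. Qed.

Lemma adjoint_linear : linear adjoint.
Proof. by move=> k g h; apply: dualP. Qed.

(** With [adjoint_linear], this makes the adjoint of a linear contraction a linear contraction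
    again, so the construction can be applied twice. *)
Lemma adjoint_le g : `|adjoint g| <= `|g|.
Proof. exact: (@opnorm_le _ _ (adjoint g) _ (opnorm_ge0 g) (adjoint_fun_le g)). Qed.

End Adjoint.

Section Biadjoint.
Context {R : realType} {V W : normedModType R[i]}.
Variables (T : V -> W) (T_linear : linear T) (T_le : forall x, `|T x| <= `|x|).

(** The second adjoint of [T], which serves as the push-forward of means along [T]. *)
Definition biadjoint : dual (dual V) -> dual (dual W) :=
  adjoint (adjoint_linear T_linear T_le) (adjoint_le T_linear T_le).

Lemma biadjointE m g : biadjoint m g = m (adjoint T_linear T_le g).
Proof. by []. Qed.

End Biadjoint.

Lemma bmul0r (K : numFieldType) (A : banachAlgType K) (a : A) : bmul a 0 = 0.
Proof. by rewrite -[0 in LHS](scale0r a) bmulZr scale0r. Qed.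

Lemma bmul0l (K : numFieldType) (A : banachAlgType K) (a : A) : bmul 0 a = 0.
Proof. by rewrite -[0 in LHS](scale0r a) bmulZl scale0r. Qed.

Lemma dual_actE (R : realType) (A : banachAlgType R[i]) (f : dual A) (a b : A) :
  dual_act f a b = f (bmul a b).
Proof. by []. Qed.

Lemma exists_character_eq1 (R : realType) (A : banachAlgType R[i])
  (theta : character A) : exists a, theta a = 1.
Proof.
have [a a0] := character_neq0 theta; exists ((theta a)^-1 *: a).
by rewrite linearZ /= /GRing.scale/= mulVf.
Qed.

Section LauSumAmenable.
Context {R : realType} {A B : banachAlgType R[i]} (phi : character B).
Variable varphi : character A.
Local Notation S := (lau_sum A phi).

Definition lau_inl (a : A) : S := (a, 0).
Definition lau_fst (x : S) : A := x.1.

Lemma lau_inl_linear : linear lau_inl.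
Proof. by move=> k a b; congr pair; rewrite /= scaler0 addr0. Qed.

Lemma lau_inl_le a : `|lau_inl a| <= `|a|.
Proof. by rewrite lau_normE /= normr0 addr0. Qed.

Lemma lau_fst_linear : linear lau_fst. Proof. by []. Qed.

(** Since [phi 0 = 0], the pairs (a, 0) form an ideal, on which [x] acts like the element
    [x.1 + phi x.2] of a unitization of [A]. *)
Lemma bmul_lau_inl (x : S) (a : A) :
  bmul x (lau_inl a) = lau_inl (bmul x.1 a + phi x.2 *: a).
Proof.
by congr pair; rewrite /= ?bmul0r// linear0 scale0r addr0.
Qed.

Lemma lau_inl_bmul (a : A) (x : S) :
  bmul (lau_inl a) x = lau_inl (bmul a x.1 + phi x.2 *: a).
Proof.
by congr pair; rewrite /= ?bmul0l// linear0 scale0r addr0.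
Qed.

Local Notation inl_adjoint := (adjoint lau_inl_linear lau_inl_le).
Local Notation fst_adjoint := (adjoint lau_fst_linear (@lau_norm1_le _ _ _ phi)).

Lemma amenable_rho : amenable varphi -> amenable (rho phi varphi).
Proof.
move=> [n [n1 nE]]; exists (biadjoint lau_inl_linear lau_inl_le n); split.
  rewrite biadjointE -n1; congr (n _); apply: dualP => a.
  by rewrite adjointE /= /rho_fun /= linear0 addr0.
move=> F x; rewrite !biadjointE.
(* Applied to the right-hand side, [n] produces the factor [varphi x.1 + phi x.2], which is the
   value of the character at [x]. *)
have -> : inl_adjoint (dual_act F x) =
    dual_act (inl_adjoint F) x.1 + phi x.2 *: inl_adjoint F.
  apply: dualP => a; rewrite adjointE dual_actE bmul_lau_inl.
  by rewrite addrC lau_inl_linear linearP addrC.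
by rewrite linearD linearZ /= nE -mulrDl.
Qed.

Lemma rho_amenable : amenable (rho phi varphi) -> amenable varphi.
Proof.
move=> [m [m1 mE]].
have [a0 a01] := exists_character_eq1 varphi.
have rho_inl a : rho phi varphi (lau_inl a) = varphi a.
  by rewrite /= /rho_fun /= linear0 addr0.
have mE0 F : m (dual_act F (lau_inl a0)) = m F.
  by rewrite mE rho_inl a01 mul1r.
exists (biadjoint lau_fst_linear (@lau_norm1_le _ _ _ phi) m); split.
  (* [varphi] composed with the projection is not the character of the sum, but becomes it once
     acted on by (a0, 0): [varphi (a0 x.1 + phi x.2 a0) = varphi x.1 + phi x.2]. *)
  rewrite biadjointE -mE0 -m1; congr (m _); apply: dualP => x.
  rewrite dual_actE lau_inl_bmul /= /lau_fst /rho_fun /=.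
  by rewrite linearD linearZ /= characterM a01 mul1r /GRing.scale/= mulr1.
move=> f a; rewrite [LHS]biadjointE [X in _ * X]biadjointE.
rewrite -[LHS]mE0.
(* Both sides send [x] to [f (a (a0 x.1 + phi x.2 a0))]: left multiplication by [a] is absorbed into
   the ideal element, and the character takes the value [varphi a] at (a a0, 0). *)
have -> : dual_act (fst_adjoint (dual_act f a)) (lau_inl a0) =
    dual_act (fst_adjoint f) (lau_inl (bmul a a0)).
  apply: dualP => x; rewrite [LHS]dual_actE [RHS]dual_actE 2!lau_inl_bmul.
  rewrite [LHS]adjointE [LHS]dual_actE [RHS]adjointE.
  by rewrite bmulDr bmulZr bmulA.
by rewrite mE rho_inl characterM a01 mulr1.
Qed.

End LauSumAmenable.

Theorem theorem4p7 (R : realType) (A B : banachAlgType R[i])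
    (phi : character B) (varphi : character A) :
  amenable (rho phi varphi) <-> amenable varphi.
Proof. by split; [exact: rho_amenable | exact: amenable_rho]. Qed.
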